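(* (Reduced Model II.) In the setting of the context, suppose that the metric $G$ used in the flow equation does not depend on $\lambda$ and is $$G=G(u,v,0)=\begin{bmatrix}g_{11}&g_{12}&0\\ g_{21}&g_{22}&0\\0&0&1\end{bmatrix},$$ where $g=[g_{ij}]_{i,j=1,2}$ is the first fundamental form of $\mathbf r(u,v)$. Let $W$ be independent of $\lambda$ and satisfy the thickness-integrated flow equation $$-\frac{Q}{|\Omega|}\int_{-h}^{h}\sqrt{|G|}\,d\lambda=\int_{-h}^{h}\Big[\sum_{i,j=1}^{2}\partial_i\big(f_\beta(\|\nabla_GW\|_G)\sqrt{|G|}\,G^{ij}\partial_jW\big)+\partial_\lambda\big(f_\beta(\|\nabla_GW\|_G)\sqrt{|G|}\,\partial_\lambda W\big)\Big]d\lambda$$ with $h=h(u,v)$, and the boundary conditions $$W=0\ \text{on }\Gamma_w,\qquad \mathbf v\cdot\mathbf n_f^{\pm}=-q^{\pm}(u,v)\ \text{on }\Gamma_f^{\pm},\qquad \mathbf v\cdot\mathbf n=0\ \text{on }\Gamma_{f_{out}}\cup\Gamma_{out}^{\pm},$$ where $\mathbf v=-f_\beta(\|\nabla_GW\|_G)\nabla_GW$. Then $$-2\sum_{i,j=1}^{2}\partial_i\Big(h(u,v)\,f_\beta(\|\nabla_gW\|_g)\sqrt{|g|}\,g^{ij}\,\partial_jW\Big)=2\frac{Q}{|\Omega|}h(u,v)\sqrt{|g|}+\tilde q^+(u,v)+\tilde q^-(u,v),$$ where $$\tilde q^{\pm}(u,v)=q^{\pm}\sqrt{1+h_u^2+h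_v^2}\,\sqrt{|g|}.$$
   Context: Geometry. $\mathbf r(u,v)$, $0\le u\le L$, $a\le v\le b$, is a smooth surface immersed in $\mathbb R^3$, with first fundamental form $g_{11}=\langle\mathbf r_u,\mathbf r_u\rangle$, $g_{12}=g_{21}=\langle\mathbf r_u,\mathbf r_v\rangle$, $g_{22}=\langle\mathbf r_v,\mathbf r_v\rangle$, $|g|=\det g$, $g^{-1}=[g^{ij}]$, and $h(u,v)>0$ is a smooth function. The fracture is $\mathbf R(u,v,\lambda)=\mathbf r(u,v)+\lambda\,\mathbf n(u,v)$, $-h\le\lambda\le h$, with $\mathbf n=\frac{\mathbf r_u\times\mathbf r_v}{\|\mathbf r_u\times\mathbf r_v\|}$; its induced metric at $\lambda=0$ is the matrix $G(u,v,0)$ displayed in the claim, and the model takes this as the metric for all $\lambda$. Write $|G|=\det G$, $G^{-1}=[G^{ij}]$, $\partial_1=\partial_u,\partial_2=\partial_v,\partial_3=\partial_\lambda$. In coordinates: $\Omega_f=\{0<u<L,\ a<v<b,\ -h(u,v)<\lambda<h(u,v)\}$; $\Gamma_w$ is the part of $\partial\Omega_f$ with $u=0$; $\Gamma_f^\pm$ the part with $\lambda=\pm h(u,v)$; $\Gamma_{f_{out}}$ the part with $u=L$; $\Gamma_{out}^+$, $\Gamma_{out}^-$ the parts with $v=b$, $v=a$. Operators. $(\nabla_G\phi)^j=\sum_{i=1}^3G^{ij}\partial_i\phi$, $\|\nabla_G\phi\|_G^2=\sum_{i,j=1}^3G^{ij}\partial_i\phi\,\partial_j\phi$, $\|\nabla_g\phi\|_g^2=\sum_{i,j=1}^2g^{ij}\partial_i\phi\,\partial_j\phi$.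 $f_\beta(s)=\dfrac{2}{\alpha+\sqrt{\alpha^2+4\beta s}}$ with constants $\alpha>0,\beta\ge0$. Normals. In boundary conditions, $\mathbf v\cdot\mathbf n$ is the dot product of the coordinate components of $\mathbf v$ in $(u,v,\lambda)$-coordinates with the unit outward normal in $(u,v,\lambda)$-space; in particular $\mathbf n_f^{\pm}=\frac{\langle -h_u,-h_v,\pm1\rangle}{\sqrt{1+h_u^2+h_v^2}}$ on $\Gamma_f^\pm$. $Q$ and $|\Omega|>0$ are constants, $q^\pm(u,v)$ are given functions; $W$ and its gradient are $C^2$ on $\overline{\Omega_f}$. *)

(* Defs.v *)
From HB Require Import structures.
From mathcomp Require Import all_boot all_order all_algebra.
From mathcomp Require Import all_classical all_reals all_analysis.
Set Implicit Arguments.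
Unset Strict Implicit.
Unset Printing Implicit Defensive.
Import Order.TTheory GRing.Theory Num.Theory.
Import numFieldNormedType.Exports.
Local Open Scope classical_set_scope.
Local Open Scope ring_scope.

(* Coordinates are numbered from 0: a point of the parameter rectangle is
   p = (u, v) : 'rV_2 and a point of the fracture is x = (u, v, lambda) : 'rV_3. *)

Definition pd (R : realType) (n : nat) (V : normedModType R) (i : 'I_n.+1)
    (f : 'rV[R]_n.+1 -> V) (x : 'rV[R]_n.+1) : V :=
  'D_(delta_mx 0 i) f x.

Fixpoint Ck_open (R : realType) (n : nat) (V : normedModType R) (k : nat)
    (U : set 'rV[R]_n.+1) (f : 'rV[R]_n.+1 -> V) : Prop :=
  match k with
  | 0 => forall x, U x -> {for x, continuous f}
  | k'.+1 => (forall x, U x -> {for x, continuous f}) /\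
             forall i : 'I_n.+1,
               (forall x, U x -> derivable f x (delta_mx 0 i)) /\
               Ck_open k' U (pd i f)
  end.

(* Regularity on a closed set A, in the usual sense of regularity on some open
   set containing A; the values of f away from A play no role. *)
Definition Ck_on (R : realType) (n : nat) (V : normedModType R) (k : nat)
    (A : set 'rV[R]_n.+1) (f : 'rV[R]_n.+1 -> V) : Prop :=
  exists U, [/\ open U, A `<=` U & Ck_open k U f].

Definition smooth_on (R : realType) (n : nat) (V : normedModType R)
    (A : set 'rV[R]_n.+1) (f : 'rV[R]_n.+1 -> V) : Prop :=
  exists U, [/\ open U, A `<=` U & forall k, Ck_open k U f].

Definition dotp (R : realType) (n : nat) (x y : 'rV[R]_n) : R :=
  \sum_(i < n) x 0 i * y 0 i.

Definition pt (R : realType) (p : 'rV[R]_2) (t : R) : 'rV[R]_3 :=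
  row_mx p (t%:M : 'rV[R]_1).

Definition uv (R : realType) (x : 'rV[R]_3) : 'rV[R]_2 :=
  @lsubmx R 1 2 1 x.

Definition lam (R : realType) (x : 'rV[R]_3) : R := x 0 ord_max.

Definition open_rect (R : realType) (L a b : R) : set 'rV[R]_2 :=
  [set p | (0 < p 0 0 < L) && (a < p 0 1 < b)].

Definition closed_rect (R : realType) (L a b : R) : set 'rV[R]_2 :=
  [set p | (0 <= p 0 0 <= L) && (a <= p 0 1 <= b)].

Definition Omega_f (R : realType) (L a b : R) (h : 'rV[R]_2 -> R)
    : set 'rV[R]_3 :=
  [set x | open_rect L a b (uv x) /\ - h (uv x) < lam x < h (uv x)].

Definition frontier (T : topologicalType) (A : set T) : set T :=
  closure A `\` interior A.

Definition Gamma_w (R : realType) (L a b : R) (h : 'rV[R]_2 -> R)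
    : set 'rV[R]_3 :=
  [set x | frontier (Omega_f L a b h) x /\ x 0 0 = 0].

Definition Gamma_fout (R : realType) (L a b : R) (h : 'rV[R]_2 -> R)
    : set 'rV[R]_3 :=
  [set x | frontier (Omega_f L a b h) x /\ x 0 0 = L].

Definition Gamma_out_plus (R : realType) (L a b : R) (h : 'rV[R]_2 -> R)
    : set 'rV[R]_3 :=
  [set x | frontier (Omega_f L a b h) x /\ x 0 1 = b].

Definition Gamma_out_minus (R : realType) (L a b : R) (h : 'rV[R]_2 -> R)
    : set 'rV[R]_3 :=
  [set x | frontier (Omega_f L a b h) x /\ x 0 1 = a].

Definition Gamma_f_plus (R : realType) (L a b : R) (h : 'rV[R]_2 -> R)
    : set 'rV[R]_3 :=
  [set x | frontier (Omega_f L a b h) x /\ lam x = h (uv x)].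

Definition Gamma_f_minus (R : realType) (L a b : R) (h : 'rV[R]_2 -> R)
    : set 'rV[R]_3 :=
  [set x | frontier (Omega_f L a b h) x /\ lam x = - h (uv x)].

Definition grad_h (R : realType) (h : 'rV[R]_2 -> R) (p : 'rV[R]_2)
    : 'rV[R]_2 :=
  \row_i pd i h p.

Definition area_h (R : realType) (h : 'rV[R]_2 -> R) (p : 'rV[R]_2) : R :=
  Num.sqrt (1 + pd 0 h p ^+ 2 + pd 1 h p ^+ 2).

Definition n_f_plus (R : realType) (h : 'rV[R]_2 -> R) (x : 'rV[R]_3)
    : 'rV[R]_3 :=
  (area_h h (uv x))^-1 *: pt (- grad_h h (uv x)) 1.

Definition n_f_minus (R : realType) (h : 'rV[R]_2 -> R) (x : 'rV[R]_3)
    : 'rV[R]_3 :=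
  (area_h h (uv x))^-1 *: pt (- grad_h h (uv x)) (-1).

Definition immersed_on (R : realType) (A : set 'rV[R]_2)
    (r : 'rV[R]_2 -> 'rV[R]_3) : Prop :=
  forall p, A p -> row_free (\matrix_(i < 2) pd i r p).

Definition fform (R : realType) (r : 'rV[R]_2 -> 'rV[R]_3) (p : 'rV[R]_2)
    : 'M[R]_2 :=
  \matrix_(i < 2, j < 2) dotp (pd i r p) (pd j r p).

Definition Gmetric (R : realType) (r : 'rV[R]_2 -> 'rV[R]_3) (x : 'rV[R]_3)
    : 'M[R]_3 :=
  block_mx (fform r (uv x)) 0 0 (1%:M : 'M[R]_1).

(* Upper-index gradient and its norm for a metric field M; used with the
   metric g in dimension 2 and with G in dimension 3. *)
Definition mgrad (R : realType) (n : nat) (M : 'rV[R]_n.+1 -> 'M[R]_n.+1)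
    (phi : 'rV[R]_n.+1 -> R) (x : 'rV[R]_n.+1) : 'rV[R]_n.+1 :=
  \row_j \sum_i invmx (M x) i j * pd i phi x.

Definition mgrad_norm (R : realType) (n : nat)
    (M : 'rV[R]_n.+1 -> 'M[R]_n.+1) (phi : 'rV[R]_n.+1 -> R)
    (x : 'rV[R]_n.+1) : R :=
  Num.sqrt (\sum_i \sum_j invmx (M x) i j * pd i phi x * pd j phi x).

Definition fbeta (R : realType) (alpha beta s : R) : R :=
  2 / (alpha + Num.sqrt (alpha ^+ 2 + 4 * beta * s)).

Definition velocity (R : realType) (alpha beta : R)
    (r : 'rV[R]_2 -> 'rV[R]_3) (W : 'rV[R]_3 -> R) (x : 'rV[R]_3)
    : 'rV[R]_3 :=
  - (fbeta alpha beta (mgrad_norm (Gmetric r) W x) *: mgrad (Gmetric r) W x).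

Definition flow_integrand (R : realType) (alpha beta : R)
    (r : 'rV[R]_2 -> 'rV[R]_3) (W : 'rV[R]_3 -> R) (x : 'rV[R]_3) : R :=
  let G := Gmetric r in
  (\sum_(i < 2) \sum_(j < 2)
     pd (lshift 1 i : 'I_3)
       (fun y => fbeta alpha beta (mgrad_norm G W y) * Num.sqrt (\det (G y))
                 * invmx (G y) (lshift 1 i) (lshift 1 j)
                 * pd (lshift 1 j : 'I_3) W y) x)
  + pd ord_max
      (fun y => fbeta alpha beta (mgrad_norm G W y) * Num.sqrt (\det (G y))
                * pd ord_max W y) x.

Definition indep_lam_on (R : realType) (A : set 'rV[R]_3)
    (W : 'rV[R]_3 -> R) : Prop :=
  forall x y, A x -> A y -> uv x = uv y -> W x = W y.

(* A lambda-independent W read as a function of (u, v); lambda = 0 always lies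
   in the fracture because h > 0. *)
Definition W_uv (R : realType) (W : 'rV[R]_3 -> R) (p : 'rV[R]_2) : R :=
  W (pt p 0).

Definition q_tilde (R : realType) (r : 'rV[R]_2 -> 'rV[R]_3)
    (h q : 'rV[R]_2 -> R) (p : 'rV[R]_2) : R :=
  q p * area_h h p * Num.sqrt (\det (fform r p)).

(* Main.v *)
(* On the fracture, W is a function w of (u, v) alone, so its lambda-derivative
   vanishes and the flow integrand is constant in lambda: the integrated equation
   reads -(Q/|Omega|) 2h sqrt|g| = 2h sum_i d_i F_i, with
   F_i = f_beta(|grad w|) sqrt|g| sum_j g^ij d_j w.  The gradient of W extends
   by continuity to the faces lambda = +-h, where the boundary condition gives
   q~(+-) = - sum_i F_i d_i h.  Since d_i (h F_i) = h d_i F_i + F_i d_i h, these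
   relations give the claim.  The product rule needs F_i to be derivable,
   including where grad w = 0 and f_beta(|grad w|) itself is not. *)

Require Import Defs.
From HB Require Import structures.
From mathcomp Require Import all_boot all_order all_algebra.
From mathcomp Require Import all_classical all_reals all_analysis.
From mathcomp Require Import ring.
Set Implicit Arguments.
Unset Strict Implicit.
Unset Printing Implicit Defensive.
Import Order.TTheory GRing.Theory Num.Theory.
Import numFieldNormedType.Exports.
Local Open Scope classical_set_scope.
Local Open Scope ring_scope.

(** * Coordinates on the fracture: [uv], [lam] and [pt] *)

Lemma uv_pt (R : realType) (p : 'rV[R]_2) (t : R) : uv (pt p t) = p.
Proof. exact: row_mxKl. Qed.

Lemma ord_max_rshift : ord_max = rshift 2 (ord0 : 'I_1) :> 'I_3.
Proof. exact: val_inj. Qed.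

Lemma lam_pt (R : realType) (p : 'rV[R]_2) (t : R) : lam (pt p t) = t.
Proof.
rewrite /lam /pt ord_max_rshift.
by rewrite (row_mxEr p (t%:M : 'rV[R]_1) 0 0) mxE eqxx mulr1n.
Qed.

Lemma uvE (R : realType) (x : 'rV[R]_3) (i : 'I_2) : uv x 0 i = x 0 (lshift 1 i).
Proof. by rewrite mxE. Qed.

Lemma uv_shift_lshift (R : realType) (x : 'rV[R]_3) (s : R) (i : 'I_2) :
  uv (s *: delta_mx 0 (lshift 1 i : 'I_3) + x) = s *: delta_mx 0 i + uv x.
Proof. by apply/rowP => j; rewrite !mxE. Qed.

Lemma uv_shift_max (R : realType) (x : 'rV[R]_3) (s : R) :
  uv (s *: delta_mx 0 ord_max + x) = uv x.
Proof.
apply/rowP => j; rewrite !mxE /= ord_max_rshift.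
have -> : (lshift 1 j == rshift 2 ord0 :> 'I_3) = false.
  exact: (@eq_lrshift 2 1 j ord0).
by rewrite mulr0 add0r.
Qed.

Lemma pt_shift (R : realType) (p : 'rV[R]_2) (t : R) :
  pt p t = t *: delta_mx 0 ord_max + pt p 0.
Proof.
have E (x y : 'rV[R]_3) : uv x = uv y -> lam x = lam y -> x = y.
  move=> /rowP xy xyl; apply/rowP => k; case: (@split_ordP 2 1 k) => j ->.
    by have := xy j; rewrite !uvE.
  by move: xyl; rewrite /lam ord_max_rshift (ord1 j).
apply: E; first by rewrite uv_shift_max !uv_pt.
rewrite lam_pt /lam mxE -[pt p 0 0 ord_max]/(lam (pt p 0)) lam_pt.
by rewrite !mxE !eqxx mulr1 addr0.
Qed.

Lemma continuous_pt (R : realType) (p : 'rV[R]_2) : continuous (pt p).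
Proof.
move=> t; rewrite (_ : pt p = fun t => t *: delta_mx 0 ord_max + pt p 0); last first.
  by apply/funext => s; rewrite pt_shift.
apply: cvgD; last exact: cvg_cst.
by apply: cvgZr_tmp; exact: cvg_id.
Qed.

Lemma continuous_lam (R : realType) : continuous (@lam R).
Proof. exact: coord_continuous. Qed.

Lemma continuous_uv (R : realType) : continuous (@uv R).
Proof.
move=> x.
rewrite (_ : @uv R = fun y : 'rV[R]_3 =>
    y 0 (lshift 1 (0 : 'I_2) : 'I_3) *: delta_mx 0 0
  + y 0 (lshift 1 (1 : 'I_2) : 'I_3) *: delta_mx 0 1).
  have c (j : 'I_3) : (y : 'rV[R]_3) 0 j @[y --> x] --> x 0 j.
    exact: coord_continuous.
  have := cvgD (cvgZr_tmp (a := delta_mx 0 0 : 'rV[R]_2) (c (lshift 1 (0 : 'I_2))))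
    (cvgZr_tmp (a := delta_mx 0 1 : 'rV[R]_2) (c (lshift 1 (1 : 'I_2)))).
  exact.
apply/funext => y; rewrite [LHS]row_sum_delta !big_ord_recl big_ord0 addr0.
by rewrite (_ : lift _ _ = 1) ?uvE//; exact: val_inj.
Qed.

(** * Partial derivatives of functions that factor through [uv] *)

Section partial_derivatives_through_uv.
Variables (R : realType) (V : normedModType R) (f : 'rV[R]_2 -> V).
Implicit Types (x : 'rV[R]_3) (i : 'I_2).

(** A shift of [x] in a base direction shifts [uv x] by the same amount, so both sides are limits of
    one and the same difference quotient; hence no derivability is assumed. *)
Lemma pd_comp_uv i x :
  pd (lshift 1 i : 'I_3) (f \o @uv R) x = pd i f (uv x).
Proof.
rewrite /pd /derive; congr (lim (_ @ 0^')); apply/funext => s /=.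
by rewrite uv_shift_lshift.
Qed.

Lemma derivable_comp_uv i x :
  derivable (f \o @uv R) x (delta_mx 0 (lshift 1 i : 'I_3)) <->
  derivable f (uv x) (delta_mx 0 i).
Proof.
rewrite /derivable; set g := (X in X @ _); set g' := (X in _ <-> cvg (X @ _)).
suff -> : g = g' by [].
by apply/funext => s; rewrite /g /g' /= uv_shift_lshift.
Qed.

Lemma pd_max_comp_uv x : pd ord_max (f \o @uv R) x = 0.
Proof.
rewrite -[RHS](@derive_cst _ _ _ (f (uv x)) x (delta_mx 0 ord_max)) /pd /derive.
congr (lim (_ @ 0^')); apply/funext => s /=.
by rewrite uv_shift_max.
Qed.

End partial_derivatives_through_uv.

(** * Calculus of derivatives along a single direction *)

Lemma derivable_coord (R : realType) (V : normedModType R) (n : nat)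
    (f : V -> 'rV[R]_n) (x v : V) (k : 'I_n) :
  derivable f x v -> derivable (fun y => f y 0 k) x v.
Proof.
move=> /cvg_ex[/= l fl]; apply/cvg_ex; exists (l 0 k).
have := cvg_comp _ _ fl (@coord_continuous _ 1 n 0 k l).
by apply: cvg_trans; apply: near_eq_cvg; apply: nearW => s /=; rewrite !mxE.
Qed.

Lemma derivable_comp1 (R : realType) (V : normedModType R) (g : R -> R)
    (f : V -> R) (x v : V) :
  derivable f x v -> derivable g (f x) 1 -> derivable (g \o f) x v.
Proof.
move=> /derivable1P/derivable1_diffP df /derivable1_diffP dg.
apply/derivable1P/derivable1_diffP.
by apply: (@differentiable_comp _ _ _ _ _ g) => //; rewrite scale0r add0r.
Qed.

Lemma derivable_sqrt (R : realType) (V : normedModType R) (f : V -> R) (x v : V) :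
  0 < f x -> derivable f x v -> derivable (Num.sqrt \o f) x v.
Proof.
by move=> fx0 df; apply: derivable_comp1 => //; have [] := is_derive1_sqrt fx0.
Qed.

Lemma derivable_bigsum (R : realType) (V W : normedModType R) (I : Type)
    (s : seq I) (f : I -> V -> W) (x v : V) :
  (forall i, derivable (f i) x v) ->
  derivable (fun y => \sum_(i <- s) f i y) x v.
Proof.
move=> df; elim: s => [|i s IH].
  by rewrite (_ : (fun y => _) = cst 0) //; apply/funext => y; rewrite big_nil.
rewrite (_ : (fun y => _) = f i + (fun y => \sum_(i <- s) f i y)); last first.
  by apply/funext => y; rewrite big_cons.
exact: derivableD.
Qed.

Lemma derivable_bigprod (R : realType) (V : normedModType R) (I : Type)
    (s : seq I) (f : I -> V -> R) (x v : V) :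
  (forall i, derivable (f i) x v) ->
  derivable (fun y => \prod_(i <- s) f i y) x v.
Proof.
move=> df; elim: s => [|i s IH].
  by rewrite (_ : (fun y => _) = cst 1) //; apply/funext => y; rewrite big_nil.
rewrite (_ : (fun y => _) = f i * (fun y => \prod_(i <- s) f i y)); last first.
  by apply/funext => y; rewrite big_cons.
exact: derivableM.
Qed.

Lemma derivable_continuous_line (R : realType) (V W : normedModType R) (f : V -> W)
    (x v : V) :
  derivable f x v -> f (s *: v + x) @[s --> (0 : R)] --> f x.
Proof.
move=> /derivable1P/derivable1_diffP/differentiable_continuous.
move=> cf; move: (cf : f (s *: v + x) @[s --> (0 : R)] --> f (0 *: v + x)).
by rewrite scale0r add0r.
Qed.

(** Since [g x = 0], the difference quotient of [f * g] is [f (s *: v + x)] times that of [g].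
    Continuity of [f] along the line therefore replaces its derivability. *)
Lemma derivableM_zero (R : realType) (V : normedModType R) (f g : V -> R) (x v : V) :
  f (s *: v + x) @[s --> (0 : R)] --> f x -> g x = 0 -> derivable g x v ->
  derivable (f * g) x v.
Proof.
move=> cf gx0 /cvg_ex[/= l gl]; apply/cvg_ex; exists (f x * l).
have cf' : f (s *: v + x) @[s --> (0 : R)^'] --> f x by exact: cvg_within_filter.
apply: cvg_trans (cvgM cf' gl); apply: near_eq_cvg; apply: nearW => s /=.
by rewrite /GRing.mul /= gx0 mulr0 !subr0 /GRing.scale /= mulrCA.
Qed.

Section derivable_invmx.
Variables (R : realType) (V : normedModType R) (x v : V).

Lemma derivable_det (n : nat) (A : V -> 'M[R]_n) :
  (forall i j, derivable (fun y => A y i j) x v) ->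
  derivable (fun y => \det (A y)) x v.
Proof.
move=> dA; apply: derivable_bigsum => s.
apply: (@derivableM _ _ (cst _)); first exact: derivable_cst.
exact: derivable_bigprod.
Qed.

Lemma derivable_invmx (n : nat) (A : V -> 'M[R]_n) (i j : 'I_n) :
  (\forall y \near x, A y \in unitmx) ->
  (forall i j, derivable (fun y => A y i j) x v) ->
  derivable (fun y => invmx (A y) i j) x v.
Proof.
move=> uA dA.
(* Cramer's rule holds only where [A y] is invertible, because [invmx] returns its argument
   elsewhere; invertibility is therefore asked on a neighbourhood. *)
apply: (@near_eq_derivable _ _ _ (fun y => (\det (A y))^-1 * cofactor (A y) j i)).
  by apply: filterS uA => y yu; rewrite /invmx yu !mxE.
apply: (@derivableM _ _ (fun y => (\det (A y))^-1)).
  apply: derivableV; last exact: derivable_det.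
  by have := nbhs_singleton uA; rewrite unitmxE unitfE.
apply: (@derivableM _ _ (cst _)); first exact: derivable_cst.
apply: derivable_det => k l.
by rewrite (_ : (fun y => _) = fun y => A y (lift j k) (lift i l));
  [exact: dA|apply/funext => y; rewrite !mxE].
Qed.

End derivable_invmx.

(** * Regularity of f_beta and of the flux *)

Section fbeta_flux.
Variables (R : realType) (alpha beta : R).
Hypotheses (alpha0 : 0 < alpha) (beta0 : 0 <= beta).

Let fbeta_den_gt0 s : 0 < alpha + Num.sqrt (alpha ^+ 2 + 4 * beta * s).
Proof. by rewrite ltr_wpDr // sqrtr_ge0. Qed.

Lemma continuous_fbeta : continuous (fbeta alpha beta).
Proof.
move=> s; apply: cvgM; first exact: cvg_cst.
apply: cvgV; first by rewrite gt_eqF.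
apply: cvgD; first exact: cvg_cst.
apply: continuous_comp; last exact: sqrt_continuous.
apply: cvgD; first exact: cvg_cst.
by apply: cvgM; [exact: cvg_cst|exact: cvg_id].
Qed.

Lemma derivable_fbeta s : 0 <= s -> derivable (fbeta alpha beta) s 1.
Proof.
move=> s0; apply: (@derivableM _ _ (cst 2)); first exact: derivable_cst.
apply: derivableV; first by rewrite gt_eqF.
apply: (@derivableD _ _ _ (cst alpha)); first exact: derivable_cst.
apply: (@derivable_sqrt _ _ (fun s => alpha ^+ 2 + 4 * beta * s)).
  by rewrite ltr_wpDr ?exprn_gt0// !mulr_ge0.
apply: (@derivableD _ _ _ (cst (alpha ^+ 2))); first exact: derivable_cst.
apply: (@derivableM _ _ (cst (4 * beta))); first exact: derivable_cst.
exact: derivable_id.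
Qed.

(* Where q vanishes, the square root is not derivable but the factor w vanishes. *)
Lemma derivable_fbeta_flux (V : normedModType R) (q w : V -> R) (x v : V) :
  derivable q x v -> derivable w x v -> (q x <= 0 -> w x = 0) ->
  derivable (fun y => fbeta alpha beta (Num.sqrt (q y)) * w y) x v.
Proof.
move=> dq dw qw; have [q0|q0] := ltP 0 (q x).
  apply: derivableM => //.
  apply: (@derivable_comp1 _ _ (fbeta alpha beta) (Num.sqrt \o q)).
    exact: derivable_sqrt.
  exact/derivable_fbeta/sqrtr_ge0.
apply: (@derivableM_zero _ _ (fun y => fbeta alpha beta (Num.sqrt (q y)))) => //.
- have c1 := cvg_comp _ _ (derivable_continuous_line dq) (@sqrt_continuous R (q x)).
  have := cvg_comp _ _ c1 (@continuous_fbeta (Num.sqrt (q x))); exact.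
- exact: qw.
Qed.

End fbeta_flux.

(** * Gram matrices: definiteness, invertibility, determinant *)

Section gram.
Variables (R : realType).

Lemma dotpE n (x y : 'rV[R]_n) : dotp x y = (x *m y^T) 0 0.
Proof. by rewrite mxE; apply: eq_bigr => i _; rewrite mxE. Qed.

Lemma dotp_eq0 n (x : 'rV[R]_n) : dotp x x <= 0 -> x = 0.
Proof.
move=> x0; have xx0 : dotp x x = 0.
  by apply/le_anti; rewrite x0 sumr_ge0// => i _; rewrite -expr2 sqr_ge0.
apply/rowP => i; rewrite mxE; apply/eqP; rewrite -sqrf_eq0 expr2.
apply/eqP; move: i isT; apply: (@psumr_eq0P _ _ _ (fun i => x 0 i * x 0 i)) => //.
by move=> i _; rewrite -expr2 sqr_ge0.
Qed.

(** The form is the squared length of [y *m J], which is nonpositive only when [y *m J = 0]; full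
    row rank then gives [y = 0]. *)
Lemma gram_definite m n (J : 'M[R]_(m, n)) (y : 'rV[R]_m) : row_free J ->
  (y *m (J *m J^T) *m y^T) 0 0 <= 0 -> y = 0.
Proof.
move=> Jfree; rewrite mulmxA -mulmxA -trmx_mul -dotpE => /dotp_eq0 yJ0.
by apply: (row_free_inj Jfree); rewrite mul0mx.
Qed.

Lemma gram_unitmx m n (J : 'M[R]_(m, n)) : row_free J -> J *m J^T \in unitmx.
Proof.
move=> Jfree; rewrite -row_free_unit; apply/inj_row_free => y yG.
by apply: (gram_definite Jfree); rewrite yG mul0mx mxE.
Qed.

(** The substitution [w = y *m G] turns the form of the inverse matrix at [w] into the form of [G]
    at [y]. It is used to deduce that a gradient of zero norm vanishes. *)
Lemma gram_inv_definite m n (J : 'M[R]_(m, n)) (w : 'rV[R]_m) : row_free J ->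
  \sum_i \sum_j invmx (J *m J^T) i j * w 0 i * w 0 j <= 0 -> w = 0.
Proof.
move=> Jfree; have Gu := gram_unitmx Jfree; set G := J *m J^T in Gu *.
have Gt : G^T = G by rewrite trmx_mul trmxK.
set y := w *m invmx G; have wE : w = y *m G by rewrite mulmxKV.
move=> q0; rewrite wE (_ : y = 0) ?mul0mx//; apply: (gram_definite Jfree).
suff -> : (y *m G *m y^T) 0 0 = \sum_i \sum_j invmx G i j * w 0 i * w 0 j by [].
rewrite -wE /y trmx_mul trmx_inv Gt mulmxA mxE exchange_big; apply: eq_bigr => j _.
rewrite !mxE mulr_suml; apply: eq_bigr => i _.
by congr (_ * _); rewrite mulrC.
Qed.

End gram.

Lemma det_mx2 (R : comPzRingType) (A : 'M[R]_2) :
  \det A = A 0 0 * A 1 1 - A 0 1 * A 1 0.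
Proof.
have l00 : lift 0 0 = 1 :> 'I_2 by exact: val_inj.
have l10 : lift 1 0 = 0 :> 'I_2 by exact: val_inj.
rewrite (expand_det_row _ 0) big_ord_recl big_ord1 l00.
rewrite /cofactor !det_mx11 !mxE /= l00 l10.
by rewrite addn0 addn1 expr0 expr1 mul1r mulN1r mulrN.
Qed.

Lemma gram2_det_gt0 (R : realType) n (J : 'M[R]_(2, n)) :
  row_free J -> 0 < \det (J *m J^T).
Proof.
move=> Jfree; set G := J *m J^T.
have G10 : G 1 0 = G 0 1 by rewrite -[G in LHS]trmxK mxE trmx_mul trmxK.
have := @gram_definite R 2 n J ^~ Jfree; rewrite -/G; move: G G10 => G G10 defG.
have posG (y : 'rV[R]_2) : y != 0 ->
    0 < y 0 0 ^+ 2 * G 0 0 + 2 * y 0 0 * y 0 1 * G 0 1 + y 0 1 ^+ 2 * G 1 1.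
  move=> /eqP y0; rewrite ltNge; apply/negP => q0; apply: y0.
  apply: defG; apply: le_trans q0; rewrite le_eqVlt.
  apply/orP; left; apply/eqP.
  have l0 : lift 0 0 = 1 :> 'I_2 by exact: val_inj.
  rewrite mxE big_ord_recl big_ord1 !l0 !mxE !big_ord_recl !big_ord0 !l0 G10; ring.
have G00 : 0 < G 0 0.
  have := posG (delta_mx 0 0); rewrite !mxE /= => /(_ _).
  rewrite expr1n mul1r mulr0 mul0r expr0n /= mul0r !addr0; apply.
  by apply/eqP => /rowP/(_ 0)/eqP; rewrite !mxE /= oner_eq0.
(* On the test vector (- G01, G00) the quadratic form takes the value G00 * det G, so positivity of
   G00 gives that of the determinant. *)
have := posG (\row_j if j == 0 then - G 0 1 else G 0 0).
rewrite !mxE /= => H; rewrite det_mx2 G10 -(pmulr_rgt0 _ G00).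
rewrite (_ : G 0 0 * _ = (- G 0 1) ^+ 2 * G 0 0
  + 2 * - G 0 1 * G 0 0 * G 0 1 + G 0 0 ^+ 2 * G 1 1); last by ring.
apply: H; apply/eqP => /rowP/(_ 1)/eqP; rewrite !mxE /=.
by rewrite gt_eqF.
Qed.

(** * The block metric G and its reduction to g *)

Lemma invmx_block1 (R : comUnitRingType) m n (A : 'M[R]_m) :
  invmx (block_mx A 0 0 (1%:M : 'M[R]_n)) = block_mx (invmx A) 0 0 1%:M.
Proof.
have [uA|uA] := boolP (A \in unitmx).
  by rewrite invmx_block_diag ?invmx1// block_diag_mx_unit uA unitmx1.
(* If [A] is singular, so is the block matrix, and [invmx] leaves both unchanged; the identity thus
   holds for every [A]. *)
by rewrite !invmx_out// inE /= block_diag_mx_unit negb_and uA.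
Qed.

Lemma sum_ord3 (R : nmodType) (f : 'I_3 -> R) :
  \sum_i f i = \sum_(i < 2) f (lshift 1 i) + f ord_max.
Proof. by rewrite (@big_split_ord _ _ _ 2 1) /= big_ord1 -ord_max_rshift. Qed.

Section block_metric.
Variables (R : realType) (r : 'rV[R]_2 -> 'rV[R]_3).
Implicit Types x : 'rV[R]_3.

Lemma det_Gmetric x : \det (Gmetric r x) = \det (fform r (uv x)).
Proof.
have := @det_ublock R 2 1 (fform r (uv x)) 0 1%:M.
by rewrite det1 mulr1; exact.
Qed.

Lemma invmx_Gmetric x :
  invmx (Gmetric r x) = block_mx (invmx (fform r (uv x))) 0 0 1%:M.
Proof. exact: (@invmx_block1 R 2 1). Qed.

Lemma invmx_Gmetric_lshift x (i j : 'I_2) :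
  invmx (Gmetric r x) (lshift 1 i) (lshift 1 j) = invmx (fform r (uv x)) i j.
Proof. by rewrite invmx_Gmetric; exact: block_mxEul. Qed.

Lemma invmx_Gmetric_lshift_max x (i : 'I_2) :
  invmx (Gmetric r x) (lshift 1 i) ord_max = 0.
Proof.
rewrite invmx_Gmetric ord_max_rshift.
by apply: etrans (block_mxEur _ _ _ _ _ _) _; rewrite mxE.
Qed.

Variables (W : 'rV[R]_3 -> R) (w : 'rV[R]_2 -> R) (x : 'rV[R]_3).
Hypotheses (W_max : pd ord_max W x = 0)
  (W_lshift : forall i : 'I_2, pd (lshift 1 i : 'I_3) W x = pd i w (uv x)).

Lemma mgrad_norm_Gmetric :
  mgrad_norm (Gmetric r) W x = mgrad_norm (fform r) w (uv x).
Proof.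
rewrite /mgrad_norm; congr Num.sqrt.
rewrite sum_ord3 [X in _ + X]big1 ?addr0; last first.
  by move=> j _; rewrite W_max mulr0 mul0r.
apply: eq_bigr => i _; rewrite sum_ord3 W_max mulr0 addr0.
by apply: eq_bigr => j _; rewrite invmx_Gmetric_lshift !W_lshift.
Qed.

Lemma mgrad_Gmetric_lshift (j : 'I_2) :
  mgrad (Gmetric r) W x 0 (lshift 1 j) = mgrad (fform r) w (uv x) 0 j.
Proof.
rewrite !mxE sum_ord3 W_max mulr0 addr0.
by apply: eq_bigr => i _; rewrite invmx_Gmetric_lshift W_lshift.
Qed.

Lemma mgrad_Gmetric_max : mgrad (Gmetric r) W x 0 ord_max = 0.
Proof.
rewrite mxE sum_ord3 W_max mulr0 addr0 big1// => i _.
by rewrite invmx_Gmetric_lshift_max mul0r.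
Qed.

End block_metric.

(** * Functions constant on an open interval or on a dense part *)

Lemma Rintegral_itv_cst_in (R : realType) (x y c : R) (f : R -> R) : x <= y ->
  (forall t, x < t < y -> f t = c) ->
  Rintegral lebesgue_measure `[x, y] f = c * (y - x).
Proof.
move=> xy fc.
have fE : {in `]x, y[, f =1 cst c} by move=> t; rewrite in_itv /= => /fc.
(* The end points form a null set. This matters because the flow integrand is known only strictly
   between the two faces. *)
rewrite /Rintegral (@eq_integral_itv_bounded _ _ _ (cst c))//.
- rewrite -/(Rintegral _ _ _) Rintegral_cst//= lebesgue_measure_itv /= lte_fin.
  by move: xy; rewrite le_eqVlt => /predU1P[->|->//]; rewrite ltxx subrr.
- apply: (@eq_measurable_fun _ _ _ _ _ (cst c)) => // t; rewrite inE => /fE //.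
Qed.

Lemma continuous_closure_cst (R : realType) (T : topologicalType) (f : T -> R)
    (B : set T) (x : T) (c : R) :
  {for x, continuous f} -> closure B x -> (forall y, B y -> f y = c) -> f x = c.
Proof.
move=> cf clB fc; apply/eqP; apply: contrapT => /negP fxc.
have : nbhs (f x) [set z | z != c].
  by apply: open_nbhs_nbhs; split; [exact: open_neq|exact: fxc].
by move=> /cf /clB [y [By]] /=; rewrite fc// eqxx.
Qed.

(** * Topology of the fracture domain *)

Section fracture_geometry.
Variables (R : realType) (L a b : R) (h : 'rV[R]_2 -> R).
Hypothesis h_cont : forall p, open_rect L a b p -> {for p, continuous h}.
Implicit Types (p : 'rV[R]_2) (x : 'rV[R]_3).

Lemma near_open_rect p : open_rect L a b p -> \forall q \near p, open_rect L a b q.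
Proof.
move=> /andP[/andP[u0 uL] /andP[va vb]].
have c (j : 'I_2) : (q : 'rV[R]_2) 0 j @[q --> p] --> p 0 j.
  exact: coord_continuous.
near=> q; apply/andP; split; apply/andP; split; near: q.
- exact: cvgr_gt (c 0) _ u0.
- exact: cvgr_lt (c 0) _ uL.
- exact: cvgr_gt (c 1) _ va.
- exact: cvgr_lt (c 1) _ vb.
Unshelve. all: by end_near. Qed.

(** The domain is cut out by strict inequalities between functions continuous at its points.
    Openness allows identities on the fracture to be differentiated. *)
Lemma near_Omega_f x : Omega_f L a b h x -> \forall y \near x, Omega_f L a b h y.
Proof.
move=> [px /andP[hx1 hx2]].
have hc : h (uv y) @[y --> x] --> h (uv x).
  exact: cvg_comp _ _ (@continuous_uv R x) (h_cont px).
have lc : lam y @[y --> x] --> lam x := @continuous_lam R x.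
near=> y; split; first by near: y; exact: (@continuous_uv R x) (near_open_rect px).
apply/andP; split.
  rewrite -subr_gt0; near: y; apply: (cvgr_gt (lam x - - h (uv x))).
    by apply: cvgB => //; exact: cvgN.
  by rewrite subr_gt0.
rewrite -subr_gt0; near: y; apply: (cvgr_gt (h (uv x) - lam x)).
  exact: cvgB.
by rewrite subr_gt0.
Unshelve. all: by end_near. Qed.

Lemma Omega_f_pt p t : open_rect L a b p -> - h p < t < h p ->
  Omega_f L a b h (pt p t).
Proof. by move=> pO th; split; rewrite ?lam_pt uv_pt. Qed.

Lemma closure_segment p t : 0 < h p -> `|t| <= h p ->
  closure [set pt p s | s in [set s | - h p < s < h p]] (pt p t).
Proof.
move=> h0 th A /(@continuous_pt R p) At.
(* The heights (1 - e) t with 0 < e < 1 lie strictly between the faces even when |t| = h, and tend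
   to t as e decreases to 0. *)
have c : (1 - e) * t @[e --> (0 : R)] --> t.
  rewrite -[X in _ --> X]mul1r -[X in _ --> X * t]subr0.
  by apply: cvgM; [apply: cvgB; [exact: cvg_cst|exact: cvg_id]|exact: cvg_cst].
have : \forall e \near (0 : R)^'+, [/\ 0 < e, e < 1 & A (pt p ((1 - e) * t))].
  near=> e; split; near: e; first exact: nbhs_right_gt.
    exact: nbhs_right_lt.
  exact: cvg_at_right_filter c _ At.
move=> /filter_ex[e [e0 e1 Ae]]; exists (pt p ((1 - e) * t)); split => //.
exists ((1 - e) * t) => //=; rewrite -ltr_norml normrM gtr0_norm ?subr_gt0//.
have : (1 - e) * `|t| <= (1 - e) * h p by rewrite ler_wpM2l// subr_ge0 ltW.
by move=> /le_lt_trans; apply; rewrite gtr_pMl// ltrBlDr ltrDl.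
Unshelve. all: by end_near. Qed.

Lemma closure_Omega_f_pt p t : open_rect L a b p -> 0 < h p -> `|t| <= h p ->
  closure (Omega_f L a b h) (pt p t).
Proof.
move=> pO h0 /(closure_segment h0); apply: closure_subset => _ [s sh <-].
exact: Omega_f_pt.
Qed.

Lemma frontier_Omega_f_pt p t : open_rect L a b p -> 0 < h p -> `|t| = h p ->
  frontier (Omega_f L a b h) (pt p t).
Proof.
move=> pO h0 th; split; first by apply: closure_Omega_f_pt; rewrite ?th.
move=> /interior_subset[_]; rewrite uv_pt lam_pt -ltr_norml th ltxx; exact.
Qed.

End fracture_geometry.

(** * Regularity and positivity of the first fundamental form *)

Lemma fform_gram (R : realType) (r : 'rV[R]_2 -> 'rV[R]_3) (p : 'rV[R]_2) :
  fform r p = (\matrix_(i < 2) pd i r p) *m (\matrix_(i < 2) pd i r p)^T.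
Proof.
by apply/matrixP => i j; rewrite !mxE; apply: eq_bigr => k _; rewrite !mxE.
Qed.

Section fform_regularity.
Variables (R : realType) (L a b : R) (r : 'rV[R]_2 -> 'rV[R]_3).
Hypotheses (hr : smooth_on (closed_rect L a b) r)
  (himm : immersed_on (closed_rect L a b) r).

Lemma open_rect_closed p : open_rect L a b p -> closed_rect L a b p.
Proof.
move=> /andP[/andP[? ?] /andP[? ?]].
by apply/andP; split; apply/andP; split; exact: ltW.
Qed.

Lemma derivable_fform p i j k : open_rect L a b p ->
  derivable (fun q => fform r q i j) p (delta_mx 0 k).
Proof.
move=> /open_rect_closed pC; have [U [_ sU /(_ 2%N)[_ Cr]]] := hr.
have dr l : derivable (pd l r) p (delta_mx 0 k).
  by have [_ [_ /(_ k)[+ _]]] := Cr l; apply; exact: sU.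
rewrite (_ : (fun q => _) =
    fun q => \sum_(l < 3) pd i r q 0 l * pd j r q 0 l); last first.
  by apply/funext => q; rewrite mxE.
by apply: derivable_bigsum => l; apply: derivableM; exact: derivable_coord.
Qed.

Lemma fform_unit p : open_rect L a b p -> fform r p \in unitmx.
Proof. by move=> /open_rect_closed/himm; rewrite fform_gram; exact: gram_unitmx. Qed.

Lemma det_fform_gt0 p : open_rect L a b p -> 0 < \det (fform r p).
Proof. by move=> /open_rect_closed/himm; rewrite fform_gram; exact: gram2_det_gt0. Qed.

(** Needed because [mgrad] contracts the first index of the inverse metric, whereas the flux in the
    flow equation contracts the second. *)
Lemma invmx_fform_sym p i j : invmx (fform r p) i j = invmx (fform r p) j i.
Proof.
by rewrite -[in LHS](trmxK (invmx _)) mxE trmx_inv fform_gram trmx_mul trmxK.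
Qed.

Lemma derivable_invmx_fform p i j k : open_rect L a b p ->
  derivable (fun q => invmx (fform r q) i j) p (delta_mx 0 k).
Proof.
move=> pO; apply: derivable_invmx; last by move=> ? ?; exact: derivable_fform.
by apply: filterS (near_open_rect pO) => q; exact: fform_unit.
Qed.

Lemma derivable_sqrt_det_fform p k : open_rect L a b p ->
  derivable (fun q => Num.sqrt (\det (fform r q))) p (delta_mx 0 k).
Proof.
move=> pO; apply: (@derivable_sqrt _ _ (fun q => \det (fform r q))).
  exact: det_fform_gt0.
by apply: derivable_det => ? ?; exact: derivable_fform.
Qed.

Lemma derivable_flux (alpha beta : R) (w : 'rV[R]_2 -> R) p i j k :
  0 < alpha -> 0 <= beta -> open_rect L a b p ->
  (forall i, derivable (pd i w) p (delta_mx 0 k)) ->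
  derivable (fun q => fbeta alpha beta (mgrad_norm (fform r) w q)
      * Num.sqrt (\det (fform r q)) * invmx (fform r q) i j * pd j w q)
    p (delta_mx 0 k).
Proof.
move=> alpha0 beta0 pO dw.
(* The factor f_beta, possibly not derivable where the gradient vanishes, is paired with [pd j w],
   which vanishes there too; the remaining factors are derivable. *)
rewrite (_ : (fun q => _) =
    (fun q => fbeta alpha beta (mgrad_norm (fform r) w q) * pd j w q)
    * ((fun q => Num.sqrt (\det (fform r q)))
       * (fun q => invmx (fform r q) i j))); last first.
  by apply/funext => q; rewrite !fctE; ring.
apply: derivableM; last first.
  by apply: derivableM; [exact: derivable_sqrt_det_fform|exact: derivable_invmx_fform].
apply: derivable_fbeta_flux => //.
  apply: derivable_bigsum => l; apply: derivable_bigsum => m.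
  apply: derivableM => //; apply: (derivableM _ (dw l)).
  exact: derivable_invmx_fform.
(* The immersion makes the inverse metric definite, so a nonpositive squared norm forces the whole
   gradient to vanish. *)
move=> q0; have : (\row_l pd l w p) = 0.
  apply: (gram_inv_definite (himm (open_rect_closed pO))); apply: le_trans q0.
  rewrite le_eqVlt; apply/orP; left; apply/eqP; apply: eq_bigr => l _.
  by apply: eq_bigr => m _; rewrite !mxE -fform_gram.
by move=> /rowP/(_ j); rewrite !mxE.
Qed.

End fform_regularity.

(** * The potential W and its reduction to two variables *)

Section potential.
Variables (R : realType) (L a b : R) (h : 'rV[R]_2 -> R) (W : 'rV[R]_3 -> R).
Hypotheses (h_cont : forall p, open_rect L a b p -> {for p, continuous h})
  (h_gt0 : forall p, open_rect L a b p -> 0 < h p)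
  (hW : Ck_on 2 (closure (Omega_f L a b h)) W)
  (hWlam : indep_lam_on (closure (Omega_f L a b h)) W).
Implicit Types (p : 'rV[R]_2) (x : 'rV[R]_3).

Lemma W_uvE x : Omega_f L a b h x -> W x = (W_uv W \o @uv R) x.
Proof.
move=> xO; apply: hWlam; first exact: subset_closure.
  have [pO _] := xO; apply: closure_Omega_f_pt; rewrite ?normr0 ?ltW//; exact: h_gt0.
by rewrite uv_pt.
Qed.

(** Equality at a point says nothing about derivatives; equality on a neighbourhood transfers every
    partial derivative to [W_uv W]. *)
Lemma near_W_uvE x : Omega_f L a b h x -> \forall y \near x, W y = (W_uv W \o @uv R) y.
Proof. by move=> xO; apply: filterS (near_Omega_f h_cont xO) => y; exact: W_uvE. Qed.

Lemma pd_lshift_W x (i : 'I_2) : Omega_f L a b h x ->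
  pd (lshift 1 i : 'I_3) W x = pd i (W_uv W) (uv x).
Proof. by move=> /near_W_uvE xE; rewrite -pd_comp_uv; exact: near_eq_derive. Qed.

Lemma pd_max_W x : Omega_f L a b h x -> pd ord_max W x = 0.
Proof.
by move=> /near_W_uvE xE; rewrite -(pd_max_comp_uv (W_uv W) x); exact: near_eq_derive.
Qed.

Let continuous_pd_W x (i : 'I_3) : closure (Omega_f L a b h) x ->
  {for x, continuous (pd i W)}.
Proof. by have [U [_ sU [_ CW]]] := hW; move=> /sU; have [_ [+ _]] := CW i; exact. Qed.

(** On the open vertical segment over [p] the partial derivative is constant, and it is continuous
    on the closed fracture, so the value persists at both ends. This reaches the faces, where [W]
    need not factor through [uv] on a full neighbourhood. *)
Let pd_W_segment p t (i : 'I_3) c : open_rect L a b p -> `|t| <= h p ->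
  (forall x, Omega_f L a b h x -> uv x = p -> pd i W x = c) -> pd i W (pt p t) = c.
Proof.
move=> pO th ic; have h0 := h_gt0 pO.
apply: continuous_closure_cst (closure_segment h0 th) _.
  by apply: continuous_pd_W; exact: closure_Omega_f_pt.
by move=> _ [s sh <-]; apply: ic; [exact: Omega_f_pt|rewrite uv_pt].
Qed.

Lemma pd_lshift_W_pt p t (i : 'I_2) : open_rect L a b p -> `|t| <= h p ->
  pd (lshift 1 i : 'I_3) W (pt p t) = pd i (W_uv W) p.
Proof. by move=> pO th; apply: pd_W_segment => // x xO <-; exact: pd_lshift_W. Qed.

Lemma pd_max_W_pt p t : open_rect L a b p -> `|t| <= h p ->
  pd ord_max W (pt p t) = 0.
Proof. by move=> pO th; apply: pd_W_segment => // x xO _; exact: pd_max_W. Qed.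

(** Near the midsurface point [pt p 0] the base partials of [W] factor through [uv], so the second
    derivatives of [W] there provide those of [W_uv W]. *)
Lemma derivable_pd_W_uv p (i k : 'I_2) : open_rect L a b p ->
  derivable (pd i (W_uv W)) p (delta_mx 0 k).
Proof.
move=> pO; have h0 := h_gt0 pO.
have xO : Omega_f L a b h (pt p 0) by apply: Omega_f_pt => //; rewrite oppr_lt0 h0.
have [U [_ sU [_ CW]]] := hW.
have [_ [_ /(_ (lshift 1 k))[+ _]]] := CW (lshift 1 i).
move=> /(_ _ (sU _ (subset_closure xO))) dW.
rewrite -(uv_pt p 0); apply/derivable_comp_uv; apply: near_eq_derivable dW.
by apply: filterS (near_Omega_f h_cont xO) => y; exact: pd_lshift_W.
Qed.

Variables (alpha beta : R) (r : 'rV[R]_2 -> 'rV[R]_3).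

Lemma flow_integrand_pt p t : open_rect L a b p -> - h p < t < h p ->
  flow_integrand alpha beta r W (pt p t) =
  \sum_(i < 2) \sum_(j < 2) pd i (fun q =>
    fbeta alpha beta (mgrad_norm (fform r) (W_uv W) q)
      * Num.sqrt (\det (fform r q)) * invmx (fform r q) i j * pd j (W_uv W) q) p.
Proof.
move=> pO th; have xO := Omega_f_pt pO th; have nO := near_Omega_f h_cont xO.
rewrite /flow_integrand /= [X in _ + X](_ : _ = 0) ?addr0; last first.
  (* The lambda-flux is zero on a whole neighbourhood of the point, hence so is its
     lambda-derivative at the point. *)
  rewrite -(pd_max_comp_uv (cst (0 : R)) (pt p t)); apply: near_eq_derive.
  by apply: filterS nO => y yO; rewrite pd_max_W ?mulr0.
apply: eq_bigr => i _; apply: eq_bigr => j _.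
rewrite -[in RHS](uv_pt p t) -pd_comp_uv; apply: near_eq_derive.
apply: filterS nO => y yO /=; rewrite (@mgrad_norm_Gmetric _ _ _ (W_uv W)).
- by rewrite det_Gmetric invmx_Gmetric_lshift pd_lshift_W.
- exact: pd_max_W.
- by move=> l; exact: pd_lshift_W.
Qed.

(** The velocity has no lambda-component, so the last entry [s] of the normal drops out; leaving it
    free treats both faces at once. *)
Lemma velocity_normal_pt p t s : open_rect L a b p -> `|t| <= h p ->
  dotp (velocity alpha beta r W (pt p t))
       ((area_h h p)^-1 *: pt (- grad_h h p) s) =
  (area_h h p)^-1 * \sum_(i < 2) fbeta alpha beta (mgrad_norm (fform r) (W_uv W) p)
     * mgrad (fform r) (W_uv W) p 0 i * pd i h p.
Proof.
move=> pO th; set x := pt p t.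
have W3 : pd ord_max W x = 0 by exact: pd_max_W_pt.
have W2 (i : 'I_2) : pd (lshift 1 i : 'I_3) W x = pd i (W_uv W) (uv x).
  by rewrite uv_pt; exact: pd_lshift_W_pt.
have velE k : velocity alpha beta r W x 0 k =
    - (fbeta alpha beta (mgrad_norm (fform r) (W_uv W) p) * mgrad (Gmetric r) W x 0 k).
  by rewrite /velocity mxE mxE (mgrad_norm_Gmetric _ W3 W2) uv_pt.
rewrite /dotp sum_ord3 !velE mgrad_Gmetric_max// mulr0 oppr0 mul0r addr0 mulr_sumr.
apply: eq_bigr => i _; rewrite velE (mgrad_Gmetric_lshift _ W3 W2) uv_pt.
rewrite [X in _ * X]mxE -uvE uv_pt [(- grad_h h p) 0 i]mxE [grad_h h p 0 i]mxE.
ring.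
Qed.

End potential.

(** * Assembly of the reduced equation *)

Theorem proposition4 (R : realType) (L a b : R)
  (r : 'rV[R]_2 -> 'rV[R]_3) (h : 'rV[R]_2 -> R)
  (alpha beta Q absOmega : R) (qplus qminus : 'rV[R]_2 -> R)
  (W : 'rV[R]_3 -> R)
  (hL : 0 < L) (hab : a < b)
  (hr : smooth_on (closed_rect L a b) r)
  (himm : immersed_on (closed_rect L a b) r)
  (hh : smooth_on (closed_rect L a b) h)
  (hpos : forall p, closed_rect L a b p -> 0 < h p)
  (halpha : 0 < alpha) (hbeta : 0 <= beta) (hOmega : 0 < absOmega)
  (hW : Ck_on 2 (closure (Omega_f L a b h)) W)
  (hgradW : forall i : 'I_3, Ck_on 2 (closure (Omega_f L a b h)) (pd i W))
  (hWlam : indep_lam_on (closure (Omega_f L a b h)) W)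
  (hflow : forall p, open_rect L a b p ->
     - (Q / absOmega)
       * Rintegral lebesgue_measure `[- h p, h p]
           (fun t : R => Num.sqrt (\det (Gmetric r (pt p t))))
     = Rintegral lebesgue_measure `[- h p, h p]
         (fun t : R => flow_integrand alpha beta r W (pt p t)))
  (hbc_w : forall x, Gamma_w L a b h x -> W x = 0)
  (hbc_f_plus : forall x, Gamma_f_plus L a b h x ->
     dotp (velocity alpha beta r W x) (n_f_plus h x) = - qplus (uv x))
  (hbc_f_minus : forall x, Gamma_f_minus L a b h x ->
     dotp (velocity alpha beta r W x) (n_f_minus h x) = - qminus (uv x))
  (hbc_fout : forall x, Gamma_fout L a b h x ->
     dotp (velocity alpha beta r W x) (delta_mx 0 0) = 0)
  (hbc_out_plus : forall x, Gamma_out_plus L a b h x ->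
     dotp (velocity alpha beta r W x) (delta_mx 0 1) = 0)
  (hbc_out_minus : forall x, Gamma_out_minus L a b h x ->
     dotp (velocity alpha beta r W x) (- delta_mx 0 1) = 0) :
  forall p, open_rect L a b p ->
    - 2 * (\sum_(i < 2) \sum_(j < 2)
        pd i (fun p' => h p'
                * fbeta alpha beta (mgrad_norm (fform r) (W_uv W) p')
                * Num.sqrt (\det (fform r p'))
                * invmx (fform r p') i j
                * pd j (W_uv W) p') p)
    = 2 * (Q / absOmega) * h p * Num.sqrt (\det (fform r p))
      + q_tilde r h qplus p + q_tilde r h qminus p.
Proof.
move=> p pO.
have h_gt0 q : open_rect L a b q -> 0 < h q by move=> /open_rect_closed/hpos.
have h_cont q : open_rect L a b q -> {for q, continuous h}.
  by have [U [_ sU /(_ 0%N)]] := hh => c /open_rect_closed/sU/c.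
have dh k : derivable h p (delta_mx 0 k).
  have [U [_ sU /(_ 1%N)[_ /(_ k)[+ _]]]] := hh; apply.
  exact/sU/open_rect_closed.
have h0 := h_gt0 _ pO.
have hh2 : h p - - h p = 2 * h p by ring.
set F := fun i j q => fbeta alpha beta (mgrad_norm (fform r) (W_uv W) q)
  * Num.sqrt (\det (fform r q)) * invmx (fform r q) i j * pd j (W_uv W) q.
have dF i j k : derivable (F i j) p (delta_mx 0 k).
  apply: (derivable_flux hr himm) => // l.
  exact: (derivable_pd_W_uv h_cont h_gt0 hW hWlam).
pose D := \sum_(i < 2) \sum_(j < 2) pd i (F i j) p.
pose S := \sum_(i < 2) \sum_(j < 2) F i j p * pd i h p.
(* Product rule for [h * F i j]: [D] is the divergence of the flux and [S] its pairing with the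
   gradient of [h]. *)
have -> : \sum_(i < 2) \sum_(j < 2)
        pd i (fun p' => h p'
                * fbeta alpha beta (mgrad_norm (fform r) (W_uv W) p')
                * Num.sqrt (\det (fform r p'))
                * invmx (fform r p') i j
                * pd j (W_uv W) p') p = h p * D + S.
  rewrite /D /S mulr_sumr -big_split; apply: eq_bigr => i _ /=.
  rewrite mulr_sumr -big_split; apply: eq_bigr => j _ /=.
  rewrite (_ : (fun p' => _) = h * F i j); first by rewrite /pd deriveM.
  by apply/funext => q; rewrite fctE /F !mulrA.
(* Both integrands are constant in lambda, and each integral contributes the thickness 2h. *)
have flowE : - (Q / absOmega) * (Num.sqrt (\det (fform r p)) * (2 * h p))
    = D * (2 * h p).
  have hNh : - h p <= h p by rewrite ge0_cp// ltW.
  have := hflow _ pO.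
  rewrite (Rintegral_itv_cst_in (c := Num.sqrt (\det (fform r p)))) ?hh2//; last first.
    by move=> t _; rewrite det_Gmetric uv_pt.
  rewrite (Rintegral_itv_cst_in (c := D)) ?hh2// => t th.
  exact: (flow_integrand_pt h_cont h_gt0 hWlam).
(* Multiplying by the area factor clears the normalisation of the normal; the same computation
   serves [qplus] and [qminus]. *)
have qE q : (area_h h p)^-1 * \sum_(i < 2)
     fbeta alpha beta (mgrad_norm (fform r) (W_uv W) p)
       * mgrad (fform r) (W_uv W) p 0 i * pd i h p = - q p ->
    q_tilde r h q p = - S.
  have A0 : area_h h p != 0.
    by rewrite gt_eqF// sqrtr_gt0 -addrA ltr_pwDl// addr_ge0// sqr_ge0.
  move=> /(congr1 ( *%R (area_h h p))); rewrite mulrA mulfV// mul1r mulrN => qA.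
  rewrite /q_tilde [q p * _]mulrC -[_ * q p]opprK -qA mulNr; congr (- _).
  rewrite mulr_suml; apply: eq_bigr => i _; rewrite mxE mulr_sumr !mulr_suml.
  apply: eq_bigr => j _; rewrite /F invmx_fform_sym; ring.
have qp : q_tilde r h qplus p = - S.
  apply: qE; have th : `|h p| = h p by rewrite gtr0_norm.
  rewrite -[in RHS](uv_pt p (h p)) -hbc_f_plus.
    rewrite /n_f_plus uv_pt (velocity_normal_pt h_cont h_gt0 hW hWlam) ?th//.
  by split; [exact: frontier_Omega_f_pt|rewrite lam_pt uv_pt].
have qm : q_tilde r h qminus p = - S.
  apply: qE; have th : `|- h p| = h p by rewrite normrN gtr0_norm.
  rewrite -[in RHS](uv_pt p (- h p)) -hbc_f_minus.
    rewrite /n_f_minus uv_pt (velocity_normal_pt h_cont h_gt0 hW hWlam) ?th//.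
  by split; [exact: frontier_Omega_f_pt|rewrite lam_pt uv_pt].
(* The flow equation is added to the right-hand side as a difference equal to zero, which leaves a
   polynomial identity and avoids dividing by [h p]. *)
rewrite qp qm; move: flowE => /eqP; rewrite -subr_eq0 => /eqP flowE.
rewrite -[RHS]addr0 -flowE; ring.
Qed.
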